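(* Let $\mathcal H\subset\mathcal H'$ be Hilbert spaces of dimensions $d$ and $d+1$ respectively, let $|\omega\rangle\in\mathcal H'$ be a unit vector orthogonal to $\mathcal H$, let $0\le\epsilon\le1$, and let $\Phi:\mathfrak S(\mathcal H)\to\mathfrak S(\mathcal H')$ be the erasure channel $\Phi(\sigma)=\epsilon|\omega\rangle\langle\omega|+(1-\epsilon)\sigma$. Let $\mathcal K$ be a finite-dimensional Hilbert space. Then for every quantum channel $\Omega:\mathfrak S(\mathcal K)\to\mathfrak S(\mathcal K)$ and every $\rho\in\mathfrak S(\mathcal H\otimes\mathcal K)$, $$H_{\Phi\otimes\Omega}(\rho)\ge H_\Phi(\mathrm{Tr}_{\mathcal K}(\rho))+H_\Omega(\mathrm{Tr}_{\mathcal H}(\rho)).$$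
   Context: $\mathfrak S(\cdot)$ denotes the set of density operators (and $\mathfrak S(\mathcal H)\subset\mathfrak S(\mathcal H')$ via the inclusion $\mathcal H\subset\mathcal H'$); a quantum channel is a completely positive trace-preserving linear map; $S(\sigma)=-\mathrm{Tr}(\sigma\log\sigma)$ is the von Neumann entropy. For a channel $\Psi$ with input space $\mathcal L$ and $\sigma\in\mathfrak S(\mathcal L)$, $H_\Psi(\sigma):=\min\sum_{j}\pi_jS(\Psi(\sigma_j))$, the minimum over all finite decompositions $\sigma=\sum_j\pi_j\sigma_j$ with $\{\pi_j\}$ a probability distribution and $\sigma_j\in\mathfrak S(\mathcal L)$. *)

(* Defs.v *)
From HB Require Import structures.
From mathcomp Require Import all_boot all_order all_algebra.
From mathcomp Require Import complex mxtens.
From mathcomp Require Import all_classical all_reals all_analysis.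

Set Implicit Arguments.
Unset Strict Implicit.
Unset Printing Implicit Defensive.

Import Order.TTheory GRing.Theory Num.Theory.
Local Open Scope ring_scope.
Local Open Scope classical_set_scope.

Section QI.
Variable R : realType.
Local Notation C := R[i].

Definition dagger m n (A : 'M[C]_(m, n)) : 'M[C]_(n, m) :=
  (map_mx Num.conj A)^T.

Definition psd n (A : 'M[C]_n) : Prop :=
  dagger A = A /\ forall v : 'rV[C]_n, 0 <= (v *m A *m dagger v) 0 0.

Definition density n (A : 'M[C]_n) : Prop := psd A /\ \tr A = 1.

Definition linear_map m n (f : 'M[C]_m -> 'M[C]_n) : Prop :=
  forall (a : C) (X Y : 'M[C]_m), f (a *: X + Y) = a *: f X + f Y.

(* Tensor product f (x) g of linear maps, defined on matrix units
   (the composite system C^m1 (x) C^m2 is C^(m1*m2) via mxtens_index). *)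
Definition tens_map m1 n1 m2 n2 (f : 'M[C]_m1 -> 'M[C]_n1)
  (g : 'M[C]_m2 -> 'M[C]_n2) (X : 'M[C]_(m1 * m2)) : 'M[C]_(n1 * n2) :=
  \sum_(a < m1) \sum_(b < m1) \sum_(c < m2) \sum_(e < m2)
     X (mxtens_index (a, c)) (mxtens_index (b, e))
       *: (f (delta_mx a b) *t g (delta_mx c e)).

Definition completely_positive m n (f : 'M[C]_m -> 'M[C]_n) : Prop :=
  forall (r : nat) (X : 'M[C]_(r * m)), psd X -> psd (tens_map id f X).

Definition trace_preserving m n (f : 'M[C]_m -> 'M[C]_n) : Prop :=
  forall X, \tr (f X) = \tr X.

Definition channel m n (f : 'M[C]_m -> 'M[C]_n) : Prop :=
  [/\ linear_map f, trace_preserving f & completely_positive f].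

Definition ptrace2 d k (X : 'M[C]_(d * k)) : 'M[C]_d :=
  \matrix_(a, b) \sum_(c < k) X (mxtens_index (a, c)) (mxtens_index (b, c)).
Definition ptrace1 d k (X : 'M[C]_(d * k)) : 'M[C]_k :=
  \matrix_(c, e) \sum_(a < d) X (mxtens_index (a, c)) (mxtens_index (a, e)).

Definition eigvals n (A : 'M[C]_n) : seq C :=
  sval (closed_field_poly_normal (char_poly A)).

Definition xlnx (x : R) : R := if x == 0 then 0 else x * ln x.

Definition entropy n (A : 'M[C]_n) : R :=
  - \sum_(z <- eigvals A) xlnx (complex.Re z).

(* H_Psi(s) = min over finite decompositions s = sum_j p_j s_j of
   sum_j p_j S(Psi(s_j)); rendered as the infimum of that set. *)
Definition Hmin m n (f : 'M[C]_m -> 'M[C]_n) (s : 'M[C]_m) : R :=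
  inf [set t : R | exists (N : nat) (p : 'I_N -> R) (sj : 'I_N -> 'M[C]_m),
         [/\ (forall j, 0 <= p j), \sum_(j < N) p j = 1,
             (forall j, density (sj j)),
             s = \sum_(j < N) (p j)%:C%C *: sj j &
             t = \sum_(j < N) p j * entropy (f (sj j))]].

(* The erasure channel, as a linear map on matrices:
   Phi(X) = eps Tr(X) |w><w| + (1 - eps) V X V^dagger,
   where V : C^d -> C^(d+1) is the isometric inclusion H in H'. *)
Definition erasure d (V : 'M[C]_(d.+1, d)) (w : 'cV[C]_d.+1) (eps : R)
  (X : 'M[C]_d) : 'M[C]_d.+1 :=
  ((eps%:C)%C * \tr X) *: (w *m dagger w) + ((1 - eps)%:C)%C *: (V *m X *m dagger V).

End QI.

(* Main.v *)
(** Writing h for the binary entropy, the output entropy of the erasure channel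
    tensored with Omega splits as
      S((Phi (x) Omega)(rho)) = h(eps) + eps S(Omega(rho_K)) + (1 - eps) S((id (x) Omega)(rho)),
    while H_Phi <= h(eps) by decomposing into pure states. So it suffices that
    (id (x) Omega)(rho) has at least the average output entropy of some decomposition
    of rho_K. By concavity rho may be taken pure; then the output has the same nonzero
    spectrum as the environment state of the complementary channel, which depends
    linearly on rho_K. Decomposing rho_K into pure states, concavity of the entropy
    bounds it below by the average of the environment entropies of these pure
    states, i.e. of their output entropies. *)
Require Import Defs.
From HB Require Import structures.
From mathcomp Require Import all_boot all_order all_algebra.
From mathcomp Require Import complex mxtens.
From mathcomp Require Import all_classical all_reals all_analysis.
From mathcomp Require Import ring lra.
Import Order.TTheory GRing.Theory Num.Theory.
Local Open Scope ring_scope.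

Set Implicit Arguments.
Unset Strict Implicit.
Unset Printing Implicit Defensive.

(** * Adjoints and positivity *)

Lemma daggerM (R : realType) m n p (A : 'M[R[i]]_(m, n)) (B : 'M[R[i]]_(n, p)) :
  dagger (A *m B) = dagger B *m dagger A.
Proof. by rewrite /dagger map_mxM trmx_mul. Qed.

Lemma daggerK (R : realType) m n (A : 'M[R[i]]_(m, n)) : dagger (dagger A) = A.
Proof. by apply/matrixP => i j; rewrite !mxE conjCK. Qed.

Lemma daggerZ (R : realType) m n (a : R[i]) (A : 'M[R[i]]_(m, n)) :
  dagger (a *: A) = Num.conj a *: dagger A.
Proof. by rewrite /dagger map_mxZ linearZ. Qed.

Lemma dagger_row_mx (R : realType) m n p (A : 'M[R[i]]_(m, n)) (B : 'M[R[i]]_(m, p)) :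
  dagger (row_mx A B) = col_mx (dagger A) (dagger B).
Proof. by rewrite /dagger map_row_mx tr_row_mx. Qed.

Lemma dagger1 (R : realType) n : dagger (1%:M : 'M[R[i]]_n) = 1%:M.
Proof. by rewrite /dagger map_mx1 trmx1. Qed.

Lemma dagger_tens (R : realType) m n p q (A : 'M[R[i]]_(m, n)) (B : 'M[R[i]]_(p, q)) :
  dagger (A *t B) = dagger A *t dagger B.
Proof. by rewrite /dagger map_mxT trmx_tens. Qed.

Lemma conjc_of_real (R : realType) (r : R) : Num.conj (r%:C%C) = r%:C%C.
Proof. by rewrite conj_Creal// complex_real. Qed.

Lemma psd_mul_dagger (R : realType) m n (A : 'M[R[i]]_(m, n)) : psd (A *m dagger A).
Proof.
split=> [|v]; first by rewrite daggerM daggerK.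
rewrite mulmxA -mulmxA -daggerM mxE sumr_ge0// => j _.
by rewrite !mxE mul_conjC_ge0.
Qed.

Lemma psd_conj (R : realType) m n (A : 'M[R[i]]_n) (B : 'M[R[i]]_(m, n)) :
  psd A -> psd (B *m A *m dagger B).
Proof.
move=> [hA pA]; split=> [|v]; first by rewrite !daggerM daggerK hA mulmxA.
by have := pA (v *m B); rewrite daggerM !mulmxA.
Qed.

Lemma psd_sum (R : realType) n (I : finType) (A : I -> 'M[R[i]]_n) :
  (forall i, psd (A i)) -> psd (\sum_i A i).
Proof.
move=> pA; split=> [|v].
  rewrite /dagger raddf_sum/= [LHS]raddf_sum/=.
  by apply: eq_bigr => i _; case: (pA i).
rewrite mulmx_sumr mulmx_suml summxE sumr_ge0// => i _.
by case: (pA i).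
Qed.

Lemma psdZ (R : realType) n (r : R) (A : 'M[R[i]]_n) :
  0 <= r -> psd A -> psd (r%:C%C *: A).
Proof.
move=> r0 [hA pA]; split=> [|v]; first by rewrite daggerZ hA conjc_of_real.
by rewrite -scalemxAr -scalemxAl mxE mulr_ge0 ?ler0c.
Qed.

(** * Spectra and entropy *)

(* Sylvester's identity, from the determinant of [[X, A], [B, 1]]. *)
Lemma char_poly_mulmxC (R : comNzRingType) m n (A : 'M[R]_(m, n)) (B : 'M[R]_(n, m)) :
  'X^n * char_poly (A *m B) = 'X^m * char_poly (B *m A).
Proof.
rewrite /char_poly /char_poly_mx !map_mxM.
set A' := map_mx _ A; set B' := map_mx _ B.
pose M := block_mx 'X%:M A' B' 1%:M.
(* A unitriangular column operation clears the block [B'] without changing the determinant. *)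
have e1 : \det M = \det ('X%:M - A' *m B').
  have : \det (M *m block_mx 1%:M 0 (- B') 1%:M) = \det ('X%:M - A' *m B').
    rewrite mulmx_block !mulmx1 !mulmx0 !mul1mx !add0r mulmxN subrr.
    by rewrite det_ublock det1 mulr1.
  by rewrite det_mulmx det_lblock !det1 !mulr1.
(* This row operation, of determinant ['X^n], clears the same block from the left: the scalar block
   ['X%:M] commutes with [B'], so no division by ['X] is needed. *)
have : \det (block_mx 1%:M 0 (- B') 'X%:M *m M) = 'X^m * \det ('X%:M - B' *m A').
  rewrite mulmx_block !mul1mx !mul0mx !addr0 mulmx1 mulNmx [- B' *m A']mulNmx.
  rewrite scalar_mxC addNr det_ublock det_scalar.
  by rewrite [- _ + _]addrC.
by rewrite det_mulmx det_lblock det1 mul1r det_scalar e1.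
Qed.

Lemma char_poly_eigvals (R : realType) n (A : 'M[R[i]]_n) :
  char_poly A = \prod_(z <- eigvals A) ('X - z%:P).
Proof.
rewrite /eigvals; case: closed_field_poly_normal => s /= {1}->.
by rewrite (monicP (char_poly_monic A)) scale1r.
Qed.

Lemma xlnx0 (R : realType) : xlnx (0 : R) = 0.
Proof. by rewrite /xlnx eqxx. Qed.

Lemma xlnx1 (R : realType) : xlnx (1 : R) = 0.
Proof. by rewrite /xlnx oner_eq0 ln1 mulr0. Qed.

(** [eigvals] is a chosen list of roots, so entropies are computed from any convenient
    factorisation: unique factorisation fixes the roots up to order, and the [c] extra zeros
    contribute [xlnx 0 = 0]. *)
Lemma entropy_roots (R : realType) n c (A : 'M[R[i]]_n) (s : seq R[i]) :
  'X^c * char_poly A = \prod_(z <- s) ('X - z%:P) ->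
  entropy A = - \sum_(z <- s) xlnx (complex.Re z).
Proof.
have -> : 'X^c = \prod_(z <- nseq c (0 : R[i])) ('X - z%:P).
  by rewrite big_nseq subr0 iter_mulr_1.
rewrite char_poly_eigvals -big_cat => /prod_XsubC_eq h; rewrite -(perm_big _ h).
rewrite big_cat big_nseq /= xlnx0 /entropy; congr (- _).
by rewrite iter_addr_0 mul0rn add0r.
Qed.

(* [A *m B] and [B *m A] have the same nonzero spectrum, and zero eigenvalues
   do not contribute to the entropy. *)
Lemma entropy_mulmxC (R : realType) m n (A : 'M[R[i]]_(m, n)) (B : 'M[R[i]]_(n, m)) :
  entropy (A *m B) = entropy (B *m A).
Proof.
rewrite (@entropy_roots _ _ m (B *m A) (nseq n 0 ++ eigvals (A *m B))).
  rewrite big_cat big_nseq /= xlnx0 /entropy; congr (- _).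
  by rewrite iter_addr_0 mul0rn add0r.
rewrite -char_poly_mulmxC big_cat -char_poly_eigvals big_nseq.
by rewrite subr0 iter_mulr_1.
Qed.

Lemma entropy_diag (R : realType) n (l : 'I_n -> R) :
  entropy (diag_mx (\row_i (l i)%:C%C)) = - \sum_i xlnx (l i).
Proof.
rewrite (@entropy_roots _ _ 0 _ [seq (l i)%:C%C | i : 'I_n]) ?big_image//.
rewrite expr0 mul1r char_poly_trig ?diag_mx_is_trig//.
by apply: eq_bigr => i _; rewrite !mxE eqxx.
Qed.

Lemma char_poly_block (R : comNzRingType) m n (A : 'M[R]_m) (B : 'M[R]_n) :
  char_poly (block_mx A 0 0 B) = char_poly A * char_poly B.
Proof.
rewrite /char_poly /char_poly_mx map_block_mx !map_mx0 scalar_mx_block.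
by rewrite opp_block_mx add_block_mx !subr0 det_ublock.
Qed.

Lemma entropy_block (R : realType) m n (A : 'M[R[i]]_m) (B : 'M[R[i]]_n) :
  entropy (block_mx A 0 0 B) = entropy A + entropy B.
Proof.
rewrite (@entropy_roots _ _ 0 _ (eigvals A ++ eigvals B)).
  by rewrite big_cat opprD.
by rewrite expr0 mul1r big_cat -!char_poly_eigvals char_poly_block.
Qed.

Lemma psd_diag_ge0 (R : realType) n (A : 'M[R[i]]_n) i : psd A -> 0 <= A i i.
Proof.
move=> [_ /(_ (delta_mx 0 i))]; rewrite -rowE mxE (bigD1 i)//= big1.
  by rewrite !mxE !eqxx/= conjC1 mulr1 addr0.
by move=> j /negPf ji; rewrite !mxE ji andbF conjC0 mulr0.
Qed.

(** A Hermitian matrix is normal, hence unitarily diagonalisable. Its eigenvalues are the diagonal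
    entries of the positive matrix [U *m A *m dagger U], so they come from nonnegative reals. *)
Lemma psd_spectral (R : realType) n (A : 'M[R[i]]_n) : psd A ->
  exists (U : 'M[R[i]]_n) (l : 'I_n -> R),
    [/\ U *m dagger U = 1%:M, dagger U *m U = 1%:M, forall i, 0 <= l i
      & A = dagger U *m diag_mx (\row_i (l i)%:C%C) *m U].
Proof.
move=> [hA pA].
have nA : A \is normalmx.
  by apply/normalmxP; rewrite (_ : map_mx _ _ = A)// -[RHS]hA /dagger map_trmx.
have [U [D [uU AE0]]] : exists (U : 'M[R[i]]_n) (D : 'rV[R[i]]_n),
    U \is unitarymx /\ A = invmx U *m diag_mx D *m U.
  exists (spectralmx A), (spectral_diag A); split.
    exact: spectral_unitarymx.
  exact/orthomx_spectralP.
have dE : map_mx Num.conj (trmx U) = dagger U by rewrite /dagger map_trmx.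
have UU : U *m dagger U = 1%:M by rewrite -dE; apply/unitarymxP.
have UU' : dagger U *m U = 1%:M by apply: mulmx1C.
have VE : invmx U = dagger U := etrans (invmx_unitary uU) dE.
have AE : A = dagger U *m diag_mx D *m U by rewrite -VE; exact: AE0.
have UAU : U *m A *m dagger U = diag_mx D.
  by rewrite {1}AE !mulmxA UU mul1mx -mulmxA UU mulmx1.
have D0 i : 0 <= D 0 i.
  have /(@psd_diag_ge0 _ _ _ i) : psd (U *m A *m dagger U) by exact: psd_conj.
  by rewrite UAU !mxE eqxx.
exists U, (fun i => complex.Re (D 0 i)); split; [exact: UU|exact: UU'|move=> i|].
  by have := D0 i; rewrite lecE => /andP[].
have -> : \row_i (complex.Re (D 0 i))%:C%C = D.
  by apply/rowP => i; rewrite mxE RRe_real ?ger0_real.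
exact: AE.
Qed.

Lemma entropy_spectral (R : realType) n (U : 'M[R[i]]_n) (l : 'I_n -> R) :
  U *m dagger U = 1%:M ->
  entropy (dagger U *m diag_mx (\row_i (l i)%:C%C) *m U) = - \sum_i xlnx (l i).
Proof. by move=> UU; rewrite -mulmxA entropy_mulmxC -mulmxA UU mulmx1 entropy_diag. Qed.

Lemma trace_spectral (R : realType) n (U : 'M[R[i]]_n) (l : 'I_n -> R) :
  U *m dagger U = 1%:M ->
  \tr (dagger U *m diag_mx (\row_i (l i)%:C%C) *m U) = (\sum_i l i)%:C%C.
Proof.
move=> UU; rewrite -mulmxA mxtrace_mulC -mulmxA UU mulmx1 mxtrace_diag rmorph_sum.
by apply: eq_bigr => i _; rewrite mxE.
Qed.

Lemma density_spectral (R : realType) n (A : 'M[R[i]]_n) : density A ->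
  exists (U : 'M[R[i]]_n) (l : 'I_n -> R),
    [/\ U *m dagger U = 1%:M, forall i, 0 <= l i, \sum_i l i = 1
      & A = dagger U *m diag_mx (\row_i (l i)%:C%C) *m U].
Proof.
move=> [/psd_spectral[U [l [UU _ l0 AE]]] trA]; exists U, l; split=> //.
by apply: (@complexI R); rewrite -(trace_spectral l UU) -AE trA.
Qed.

(** * Concavity of the entropy *)

Lemma xlnx_le0 (R : realType) (x : R) : 0 <= x <= 1 -> xlnx x <= 0.
Proof.
move=> /andP[x0 x1]; rewrite /xlnx; case: ifP => // _.
by rewrite mulr_ge0_le0// ln_le0.
Qed.

Lemma xlnxM (R : realType) (x y : R) : 0 <= x -> 0 <= y ->
  xlnx (x * y) = x * xlnx y + y * xlnx x.
Proof.
rewrite le_eqVlt => /predU1P[<-|x0]; first by rewrite !mul0r xlnx0 mulr0 add0r.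
rewrite le_eqVlt => /predU1P[<-|y0]; first by rewrite !(mul0r,mulr0) xlnx0 mulr0 add0r.
rewrite /xlnx mulf_eq0 !gt_eqF//= lnM ?posrE//; ring.
Qed.

(** The left side is the tangent at [m] to the convex function [x * ln x]; the bound is
    [ln y <= y - 1] at [y = m / x], multiplied by [x]. *)
Lemma xlnx_tangent (R : realType) (m x : R) : 0 < m -> 0 <= x ->
  x * ln m + x - m <= xlnx x.
Proof.
move=> m0; rewrite le_eqVlt => /predU1P[<-|x0].
  by rewrite mul0r xlnx0 !add0r oppr_le0 ltW.
have h : ln (m / x) <= m / x - 1.
  have mx0 : 0 < m / x by rewrite divr_gt0.
  have := @le_ln1Dx R (m / x - 1); rewrite [1 + _]addrC subrK; apply.
  by lra.
rewrite ln_div ?posrE// in h; rewrite /xlnx gt_eqF//.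
have := ler_wpM2l (ltW x0) h; rewrite !mulrBr mulr1 mulrCA divff ?gt_eqF// mulr1.
by move=> k; lra.
Qed.

(** Averaging the tangent bound at the mean [m] gives the claim, since the tangent values average to
    [m * ln m]. *)
Lemma xlnx_jensen (R : realType) (I : finType) (w x : I -> R) :
  (forall j, 0 <= w j) -> \sum_j w j = 1 -> (forall j, 0 <= x j) ->
  xlnx (\sum_j w j * x j) <= \sum_j w j * xlnx (x j).
Proof.
move=> w0 w1 x0; set m := \sum_j _ * x j.
have wx0 j : 0 <= w j * x j by rewrite mulr_ge0.
have : 0 <= m by apply: sumr_ge0.
rewrite le_eqVlt => /predU1P[m0|m0].
  (* At mean zero there is no tangent, but each [w j * x j] vanishes, so every term on the right is
     zero. *)
  rewrite -m0 xlnx0 sumr_ge0// => j _.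
  have /eqP : w j * x j = 0 by apply: (psumr_eq0P _ (esym m0)).
  by rewrite mulf_eq0 => /orP[]/eqP->; rewrite ?mul0r ?xlnx0 ?mulr0.
have -> : xlnx m = \sum_j w j * (x j * ln m + x j - m).
  rewrite (eq_bigr (fun j => w j * x j * (ln m + 1) - w j * m)).
    rewrite sumrB -!mulr_suml w1 -/m mul1r mulrDr mulr1 addrK.
    by rewrite /xlnx gt_eqF.
  by move=> j _; ring.
by apply: ler_sum => j _; rewrite ler_wpM2l// xlnx_tangent.
Qed.

Lemma entropy_ge0 (R : realType) n (A : 'M[R[i]]_n) : density A -> 0 <= entropy A.
Proof.
move=> /density_spectral[U [l [UU l0 l1 ->]]]; rewrite entropy_spectral// oppr_ge0.
rewrite sumr_le0// => i _; rewrite xlnx_le0// l0 -l1 (bigD1 i)//= lerDl.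
by rewrite sumr_ge0.
Qed.

(** The eigenvalues scale by [c]; the product rule [xlnxM] and trace one leave the correction
    [- xlnx c]. This handles the unnormalised blocks of a mixture. *)
Lemma entropyZ (R : realType) n (c : R) (A : 'M[R[i]]_n) : 0 <= c -> density A ->
  entropy (c%:C%C *: A) = c * entropy A - xlnx c.
Proof.
move=> c0 /density_spectral[U [l [UU l0 l1 ->]]].
have -> : c%:C%C *: (dagger U *m diag_mx (\row_i (l i)%:C%C) *m U) =
    dagger U *m diag_mx (\row_i (c * l i)%:C%C) *m U.
  rewrite scalemxAl scalemxAr -linearZ; congr (_ *m diag_mx _ *m _).
  by apply/rowP => i; rewrite !mxE rmorphM.
rewrite !entropy_spectral// mulrN -opprD; congr (- _).
rewrite (eq_bigr (fun i => c * xlnx (l i) + l i * xlnx c)) => [|i _]; last exact: xlnxM.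
by rewrite big_split -mulr_sumr -mulr_suml l1 mul1r.
Qed.

Lemma psd_real_diag (R : realType) n (A : 'M[R[i]]_n) i :
  psd A -> A i i = (complex.Re (A i i))%:C%C.
Proof. by move=> pA; rewrite RRe_real// ger0_real// psd_diag_ge0. Qed.

Lemma psd_Re_diag_ge0 (R : realType) n (A : 'M[R[i]]_n) i :
  psd A -> 0 <= complex.Re (A i i).
Proof. by move=> pA; rewrite -ler0c -psd_real_diag// psd_diag_ge0. Qed.

(* By Schur, the diagonal is a doubly stochastic average of the spectrum. *)
Lemma entropy_le_diag (R : realType) n (A : 'M[R[i]]_n) : psd A ->
  entropy A <= - \sum_a xlnx (complex.Re (A a a)).
Proof.
move=> pA; have [U [l [UU UU' l0 AE]]] := psd_spectral pA.
have wE b a : (dagger U a b * U b a) = (complex.Re (dagger U a b * U b a))%:C%C.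
  by rewrite RRe_real// ger0_real// !mxE mulrC mul_conjC_ge0.
(* [w b a] is the squared modulus of [U b a]; the two unitarity relations make [w] doubly
   stochastic. *)
pose w b a := complex.Re (dagger U a b * U b a).
have w0 b a : 0 <= w b a by rewrite -ler0c /w -wE !mxE mulrC mul_conjC_ge0.
have w1 a : \sum_b w b a = 1.
  apply: (@complexI R); rewrite rmorph_sum.
  transitivity ((dagger U *m U) a a); last by rewrite UU' mxE eqxx.
  by rewrite mxE; apply: eq_bigr => b _; exact/esym/wE.
have w2 b : \sum_a w b a = 1.
  apply: (@complexI R); rewrite rmorph_sum.
  transitivity ((U *m dagger U) b b); last by rewrite UU mxE eqxx.
  by rewrite mxE; apply: eq_bigr => a _; rewrite mulrC; exact/esym/wE.
have AaE a : complex.Re (A a a) = \sum_b w b a * l b.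
  apply: (@complexI R); rewrite -psd_real_diag// rmorph_sum {1}AE mul_mx_diag [LHS]mxE.
  apply: eq_bigr => b _; rewrite !mxE mulrAC rmorphM; congr (_ * _).
  by rewrite /w; have := wE b a; rewrite !mxE.
rewrite {1}AE entropy_spectral// lerN2.
apply: le_trans (_ : \sum_a \sum_b w b a * xlnx (l b) <= _).
  by apply: ler_sum => a _; rewrite AaE xlnx_jensen.
by rewrite exchange_big/=; apply: ler_sum => b _; rewrite -mulr_suml w2 mul1r.
Qed.

(** In an eigenbasis of the mixture, its eigenvalues are averages of the diagonals of the rotated
    [A j]. Jensen applies to each diagonal entry, and Schur's bound returns from the diagonals to
    the entropies. *)
Lemma entropy_concave (R : realType) (I : finType) n (p : I -> R) (A : I -> 'M[R[i]]_n) :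
  (forall j, 0 <= p j) -> \sum_j p j = 1 -> (forall j, psd (A j)) ->
  \sum_j p j * entropy (A j) <= entropy (\sum_j (p j)%:C%C *: A j).
Proof.
move=> p0 p1 pA; set B := \sum_j _ *: _.
have pB : psd B by apply: psd_sum => j; exact: psdZ.
have [U [l [UU UU' l0 BE]]] := psd_spectral pB.
pose A' j := U *m A j *m dagger U.
have pA' j : psd (A' j) by exact: psd_conj.
have SA' j : entropy (A' j) = entropy (A j).
  by rewrite /A' -mulmxA entropy_mulmxC -mulmxA UU' mulmx1.
have lE a : l a = \sum_j p j * complex.Re (A' j a a).
  have UBU : U *m B *m dagger U = diag_mx (\row_i (l i)%:C%C).
    by rewrite BE !mulmxA UU mul1mx -mulmxA UU mulmx1.
  apply: (@complexI R); transitivity ((U *m B *m dagger U) a a).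
    by rewrite UBU !mxE eqxx mulr1n.
  rewrite mulmx_sumr mulmx_suml summxE rmorph_sum; apply: eq_bigr => j _.
  rewrite -scalemxAr -scalemxAl mxE rmorphM; congr (_ * _).
  exact: psd_real_diag (pA' j).
rewrite {1}BE entropy_spectral//.
rewrite -lerN2 opprK -sumrN.
apply: le_trans (_ : \sum_a \sum_j p j * xlnx (complex.Re (A' j a a)) <= _).
  by apply: ler_sum => a _; rewrite lE xlnx_jensen// => j; exact: psd_Re_diag_ge0.
rewrite exchange_big/=; apply: ler_sum => j _; rewrite -mulr_sumr -mulrN.
by rewrite ler_wpM2l// -SA' lerNr entropy_le_diag.
Qed.

(** * Partial traces and Kraus operators *)

Lemma density_pure (R : realType) n (u : 'cV[R[i]]_n) :
  dagger u *m u = 1%:M -> density (u *m dagger u).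
Proof.
move=> uu; split; first exact: psd_mul_dagger.
by rewrite mxtrace_mulC uu mxtrace1.
Qed.

Lemma density_pure_decomposition (R : realType) n (A : 'M[R[i]]_n) : density A ->
  exists (l : 'I_n -> R) (u : 'I_n -> 'cV[R[i]]_n),
    [/\ forall j, 0 <= l j, \sum_j l j = 1, forall j, dagger (u j) *m u j = 1%:M
      & A = \sum_j (l j)%:C%C *: (u j *m dagger (u j))].
Proof.
move=> /density_spectral[U [l [UU l0 l1 AE]]].
(* The adjoints of the rows of [U] are the eigenvectors of [A]. *)
exists l, (fun j => dagger (row j U)); split=> // [j|].
  rewrite daggerK; apply/matrixP => a b; rewrite !ord1 !mxE eqxx.
  transitivity ((U *m dagger U) j j); last by rewrite UU mxE eqxx.
  by rewrite mxE; apply: eq_bigr => c _; rewrite !mxE.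
rewrite AE; apply/matrixP => a b; rewrite mxE summxE; apply: eq_bigr => j _.
by rewrite mul_mx_diag !mxE big_ord1 !mxE conjCK mulrAC mulrC mulrA.
Qed.

Lemma big_mxtens (V : nmodType) m n (F : 'I_(m * n) -> V) :
  \sum_x F x = \sum_a \sum_c F (mxtens_index (a, c)).
Proof.
rewrite pair_bigA (reindex (@mxtens_index m n))/=.
  by apply: eq_bigr => -[].
exists (@mxtens_unindex m n) => x _; [exact: mxtens_indexK|exact: mxtens_unindexK].
Qed.

(** * Linear maps and tensor products, block by block *)

Lemma linear_mapZ (R : realType) m n (f : 'M[R[i]]_m -> 'M[R[i]]_n) a X :
  linear_map f -> f (a *: X) = a *: f X.
Proof.
move=> fl; have f0 : f 0 = 0.
  by apply: (addIr (f 0)); have := fl 1 0 0; rewrite !scale1r !add0r.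
by rewrite -[a *: X]addr0 fl f0 addr0.
Qed.

Lemma linear_map_sum (R : realType) m n (f : 'M[R[i]]_m -> 'M[R[i]]_n)
    (I : finType) (F : I -> 'M[R[i]]_m) :
  linear_map f -> f (\sum_j F j) = \sum_j f (F j).
Proof.
move=> fl; apply: (big_morph f) => [X Y|].
  by rewrite -[X]scale1r fl !scale1r.
by rewrite -(scale0r 0) linear_mapZ// scale0r.
Qed.

(** In Dirac notation, [<a| X |b>] contracted on the first factor only. Both [tens_map id g] and
    [ptrace1] are simple in terms of these blocks. *)
Definition tens_block (R : realType) d k (X : 'M[R[i]]_(d * k)) (a b : 'I_d) : 'M[R[i]]_k :=
  mxsub (fun c => mxtens_index (a, c)) (fun e => mxtens_index (b, e)) X.

(** Linearity of [g] reassembles the inner sums over matrix units into a whole block. *)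
Lemma tens_mapE (R : realType) m1 n1 m2 n2 (f : 'M[R[i]]_m1 -> 'M[R[i]]_n1)
    (g : 'M[R[i]]_m2 -> 'M[R[i]]_n2) (X : 'M[R[i]]_(m1 * m2)) a b c e :
  linear_map g ->
  tens_map f g X (mxtens_index (a, c)) (mxtens_index (b, e)) =
  \sum_a' \sum_b' f (delta_mx a' b') a b * g (tens_block X a' b') c e.
Proof.
move=> gl; rewrite /tens_map summxE; apply: eq_bigr => a' _.
rewrite summxE; apply: eq_bigr => b' _.
rewrite [tens_block X a' b']matrix_sum_delta (linear_map_sum _ gl) !summxE mulr_sumr.
apply: eq_bigr => c' _.
rewrite (linear_map_sum _ gl) !summxE mulr_sumr; apply: eq_bigr => e' _.
by rewrite (linear_mapZ _ _ gl) !mxE !mxtens_indexK/= mulrCA.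
Qed.

Lemma tens_map_idE (R : realType) d m n (g : 'M[R[i]]_m -> 'M[R[i]]_n)
    (X : 'M[R[i]]_(d * m)) a b c e :
  linear_map g ->
  tens_map id g X (mxtens_index (a, c)) (mxtens_index (b, e)) = g (tens_block X a b) c e.
Proof.
move=> gl; rewrite tens_mapE// (bigD1 a)//= [X in _ + X]big1 => [|a' /negPf na].
  rewrite addr0 (bigD1 b)//= big1 => [|b' /negPf nb]; first by rewrite mxE !eqxx mul1r addr0.
  by rewrite mxE eqxx [b == b']eq_sym nb mul0r.
by rewrite big1// => b' _; rewrite mxE [a == a']eq_sym na mul0r.
Qed.

Lemma mul_tens1mxE (R : realType) d m n p (K : 'M[R[i]]_(n, m)) (Y : 'M[R[i]]_(d * m, p)) a c y :
  ((1%:M *t K) *m Y) (mxtens_index (a, c)) y = \sum_c' K c c' * Y (mxtens_index (a, c')) y.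
Proof.
rewrite mxE big_mxtens (bigD1 a)//= [X in _ + X]big1 => [|a' /negPf na].
  by rewrite addr0; apply: eq_bigr => c' _; rewrite tensmxE mxE eqxx mul1r.
by rewrite big1// => c' _; rewrite tensmxE mxE eq_sym na !mul0r.
Qed.

Lemma mul_mxtens1E (R : realType) d m n p (K : 'M[R[i]]_(m, n)) (Y : 'M[R[i]]_(p, d * m)) b e y :
  (Y *m (1%:M *t K)) y (mxtens_index (b, e)) = \sum_e' Y y (mxtens_index (b, e')) * K e' e.
Proof.
rewrite mxE big_mxtens (bigD1 b)//= [X in _ + X]big1 => [|b' /negPf nb].
  by rewrite addr0; apply: eq_bigr => c' _; rewrite tensmxE mxE eqxx mul1r.
by rewrite big1// => c' _; rewrite tensmxE mxE nb mul0r mulr0.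
Qed.

Lemma tens_block_conj (R : realType) d m n (K : 'M[R[i]]_(n, m)) (X : 'M[R[i]]_(d * m)) a b :
  tens_block ((1%:M *t K) *m X *m dagger (1%:M *t K)) a b =
  K *m tens_block X a b *m dagger K.
Proof.
apply/matrixP => c e; rewrite mxE dagger_tens dagger1 mul_mxtens1E [RHS]mxE.
apply: eq_bigr => e' _; rewrite mul_tens1mxE [in RHS]mxE; congr (_ * _).
by apply: eq_bigr => c' _; rewrite mxE.
Qed.

Lemma ptrace1_block (R : realType) d k (X : 'M[R[i]]_(d * k)) :
  ptrace1 X = \sum_a tens_block X a a.
Proof.
apply/matrixP => c e; rewrite mxE summxE.
by apply: eq_bigr => a _; rewrite mxE.
Qed.

(** Selecting rows and columns by the same index map is conjugation by [rowsub f 1%:M]. *)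
Lemma psd_mxsub (R : realType) m n (f : 'I_m -> 'I_n) (X : 'M[R[i]]_n) :
  psd X -> psd (mxsub f f X).
Proof.
move=> /(psd_conj (rowsub f 1%:M)); congr psd.
have -> : dagger (rowsub f (1%:M : 'M[R[i]]_n)) = colsub f 1%:M.
  by apply/matrixP => a b; rewrite !mxE rmorph_nat eq_sym.
rewrite mul_rowsub_mx mul1mx mulmx_colsub mulmx1.
by apply/matrixP => a b; rewrite !mxE.
Qed.

Lemma trace_tens (R : realType) d k (X : 'M[R[i]]_(d * k)) :
  \tr X = \sum_a \tr (tens_block X a a).
Proof.
rewrite /mxtrace big_mxtens; apply: eq_bigr => a _.
by apply: eq_bigr => c _; rewrite mxE.
Qed.

Lemma density_ptrace1 (R : realType) d k (X : 'M[R[i]]_(d * k)) :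
  density X -> density (ptrace1 X).
Proof.
move=> [pX trX]; rewrite ptrace1_block; split.
  by apply: psd_sum => a; exact: psd_mxsub.
by rewrite raddf_sum -trX trace_tens.
Qed.

Lemma density_ptrace2 (R : realType) d k (X : 'M[R[i]]_(d * k)) :
  density X -> density (ptrace2 X).
Proof.
move=> [pX trX]; split.
  have -> : ptrace2 X = \sum_c mxsub (fun a => mxtens_index (a, c))
      (fun a => mxtens_index (a, c)) X.
    apply/matrixP => a b; rewrite mxE summxE.
    by apply: eq_bigr => c _; rewrite mxE.
  by apply: psd_sum => c; exact: psd_mxsub.
rewrite -trX trace_tens; apply: eq_bigr => a _; rewrite mxE.
by apply: eq_bigr => c _; rewrite mxE.
Qed.

(** Choi's argument: complete positivity makes the Choi matrix positive, and its scaled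
    eigenvectors, reshaped into matrices, are the Kraus operators. *)
Lemma channel_kraus (R : realType) m n (f : 'M[R[i]]_m -> 'M[R[i]]_n) :
  linear_map f -> completely_positive f ->
  exists (N : nat) (K : 'I_N -> 'M[R[i]]_(n, m)),
    forall X, f X = \sum_j K j *m X *m dagger (K j).
Proof.
move=> fl fcp.
(* The unnormalised maximally entangled vector: block [(a, b)] of [v *m dagger v] is
   [delta_mx a b]. *)
pose v : 'cV[R[i]]_(m * m) :=
  \col_x ((mxtens_unindex x).1 == (mxtens_unindex x).2)%:R.
have [U [l [_ _ l0 JE]]] := psd_spectral (fcp m _ (psd_mul_dagger v)).
have fE a b c e : f (delta_mx a b) c e =
    \sum_j dagger U (mxtens_index (a, c)) j * (l j)%:C%C * U j (mxtens_index (b, e)).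
  have -> : delta_mx a b = tens_block (v *m dagger v) a b.
    apply/matrixP => c' e'; rewrite !mxE big_ord1 !mxE !mxtens_indexK/= rmorph_nat.
    by rewrite -natrM mulnb ![_ == c']eq_sym ![_ == e']eq_sym.
  rewrite -(tens_map_idE _ _ _ _ _ fl) JE mul_mx_diag mxE.
  by apply: eq_bigr => j _; rewrite !mxE.
exists (m * n)%N, (fun j => \matrix_(c, a)
  (dagger U (mxtens_index (a, c)) j * (Num.sqrt (l j))%:C%C)) => X.
apply/matrixP => c e; rewrite [X in f X]matrix_sum_delta (linear_map_sum _ fl) !summxE.
under eq_bigr => a _.
  rewrite (linear_map_sum _ fl) summxE.
  under eq_bigr => b _ do rewrite (linear_mapZ _ _ fl) mxE fE mulr_sumr.
  over.
under [RHS]eq_bigr => j _.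
  rewrite mxE.
  under eq_bigr => b _ do rewrite mxE mulr_suml.
  rewrite exchange_big.
  over.
rewrite /= [RHS]exchange_big/=; apply: eq_bigr => a _.
rewrite exchange_big/=; apply: eq_bigr => j _; apply: eq_bigr => b _.
rewrite !mxE rmorphM /= conjCK conjc_of_real.
(* One square root belongs to the Kraus operator, the other to its adjoint. *)
have -> : (l j)%:C%C = (Num.sqrt (l j))%:C%C * (Num.sqrt (l j))%:C%C.
  by rewrite -rmorphM -expr2 sqr_sqrtr.
ring.
Qed.

Lemma channel_density (R : realType) m n (f : 'M[R[i]]_m -> 'M[R[i]]_n) A :
  channel f -> density A -> density (f A).
Proof.
move=> [fl ftp fcp] [pA trA]; have [N [K fE]] := channel_kraus fl fcp.
split; last by rewrite ftp.
by rewrite fE; apply: psd_sum => j; exact: psd_conj.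
Qed.

Lemma tens_map_id_density (R : realType) d m n (f : 'M[R[i]]_m -> 'M[R[i]]_n)
    (A : 'M[R[i]]_(d * m)) :
  channel f -> density A -> density (tens_map id f A).
Proof.
move=> [fl ftp fcp] [pA trA]; split; first exact: fcp.
rewrite -trA !trace_tens; apply: eq_bigr => a _; rewrite -ftp.
by apply: eq_bigr => c _; rewrite [LHS]mxE (tens_map_idE _ _ _ _ _ fl).
Qed.

Lemma tens_map_id_kraus (R : realType) d m n (f : 'M[R[i]]_m -> 'M[R[i]]_n)
    N (K : 'I_N -> 'M[R[i]]_(n, m)) (X : 'M[R[i]]_(d * m)) :
  linear_map f -> (forall Y, f Y = \sum_j K j *m Y *m dagger (K j)) ->
  tens_map id f X = \sum_j (1%:M *t K j) *m X *m dagger (1%:M *t K j).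
Proof.
move=> fl fE; apply/matrixP => x y.
case: (mxtens_indexP x) => a c; case: (mxtens_indexP y) => b e.
rewrite (tens_map_idE _ _ _ _ _ fl) fE !summxE; apply: eq_bigr => j _.
by rewrite -tens_block_conj mxE.
Qed.

Lemma ptrace1_sum (R : realType) d k (I : finType) (q : I -> R[i])
    (X : I -> 'M[R[i]]_(d * k)) :
  ptrace1 (\sum_j q j *: X j) = \sum_j q j *: ptrace1 (X j).
Proof.
apply/matrixP => c e; rewrite mxE summxE; under eq_bigr do rewrite summxE.
rewrite exchange_big/=; apply: eq_bigr => j _.
by rewrite !mxE mulr_sumr; apply: eq_bigr => a _; rewrite [LHS]mxE.
Qed.

(** The duality characterising the partial trace: observables on the second factor see only the
    marginal. *)
Lemma trace_tens1mx (R : realType) d k (A : 'M[R[i]]_k) (X : 'M[R[i]]_(d * k)) :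
  \tr ((1%:M *t A) *m X) = \tr (A *m ptrace1 X).
Proof.
rewrite ptrace1_block mulmx_sumr raddf_sum trace_tens; apply: eq_bigr => a _.
apply: eq_bigr => c _; rewrite mxE mul_tens1mxE [RHS]mxE.
by apply: eq_bigr => c' _; rewrite [in RHS]mxE.
Qed.

(** * The complementary channel *)

(* The output on [X] of the channel complementary to the one with Kraus
   operators [K], up to transposition. *)
Definition gram (R : realType) m n N (K : 'I_N -> 'M[R[i]]_(n, m)) (X : 'M[R[i]]_m) :
    'M[R[i]]_N :=
  \matrix_(i, j) \tr (dagger (K i) *m K j *m X).

Lemma gram_sum (R : realType) m n N (K : 'I_N -> 'M[R[i]]_(n, m)) (I : finType)
    (q : I -> R[i]) (X : I -> 'M[R[i]]_m) :
  gram K (\sum_j q j *: X j) = \sum_j q j *: gram K (X j).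
Proof.
apply/matrixP => a b; rewrite mxE mulmx_sumr raddf_sum summxE.
by apply: eq_bigr => j _; rewrite !mxE -scalemxAr; exact: mxtraceZ.
Qed.

(** The products [dagger (K i) *m K j] of the extended operators act trivially on the reference
    factor, so the environment sees only the marginal of [X]. *)
Lemma gram_tens (R : realType) d m n N (K : 'I_N -> 'M[R[i]]_(n, m)) (X : 'M[R[i]]_(d * m)) :
  gram (fun j => (1%:M : 'M[R[i]]_d) *t K j) X = gram K (ptrace1 X).
Proof.
apply/matrixP => a b; rewrite !mxE dagger_tens dagger1 tensmx_mul mulmx1.
exact: trace_tens1mx.
Qed.

Section PureInput.

Variables (R : realType) (m n N : nat) (K : 'I_N -> 'M[R[i]]_(n, m)) (u : 'cV[R[i]]_m).

(** The Stinespring dilation of [u], a vector on output and environment, written as a matrix. The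
    output is [M *m dagger M] and the environment matrix is [dagger M *m M], whence equal
    entropies. *)
Let M : 'M[R[i]]_(n, N) := \matrix_(x, j) (K j *m u) x 0.

Let outputE : \sum_j K j *m (u *m dagger u) *m dagger (K j) = M *m dagger M.
Proof.
apply/matrixP => x y; rewrite summxE [RHS]mxE; apply: eq_bigr => j _.
rewrite -mulmxA -(mulmxA u) -daggerM mulmxA mxE big_ord1.
by rewrite [M x j]mxE [dagger M j y]mxE [dagger _ _ _]mxE ![map_mx _ _ _ _]mxE [M y j]mxE.
Qed.

Let gramE : gram K (u *m dagger u) = dagger M *m M.
Proof.
apply/matrixP => a b; rewrite mxE.
transitivity ((dagger (K a *m u) *m (K b *m u)) 0 0).
  by rewrite -trace_mx11 daggerM mulmxA mxtrace_mulC !mulmxA.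
rewrite mxE [RHS]mxE; apply: eq_bigr => x _.
by rewrite [M x b]mxE [dagger M a x]mxE [dagger _ _ _]mxE ![map_mx _ _ _ _]mxE [M x a]mxE.
Qed.

Lemma gram_pure_psd : psd (gram K (u *m dagger u)).
Proof. by rewrite gramE -{2}[M]daggerK; exact: psd_mul_dagger. Qed.

Lemma entropy_gram_pure :
  entropy (\sum_j K j *m (u *m dagger u) *m dagger (K j)) =
  entropy (gram K (u *m dagger u)).
Proof. by rewrite outputE gramE entropy_mulmxC. Qed.

End PureInput.

(* The environment state of a pure input depends only on its marginal, so that a
   pure-state decomposition of the marginal decomposes it; concavity concludes. *)
Lemma entropy_tens_id_pure (R : realType) d m n (f : 'M[R[i]]_m -> 'M[R[i]]_n)
    (u : 'cV[R[i]]_(d * m)) :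
  channel f -> dagger u *m u = 1%:M ->
  exists (q : 'I_m -> R) (s : 'I_m -> 'M[R[i]]_m),
    [/\ forall j, 0 <= q j, \sum_j q j = 1, forall j, density (s j),
        ptrace1 (u *m dagger u) = \sum_j (q j)%:C%C *: s j
      & \sum_j q j * entropy (f (s j)) <= entropy (tens_map id f (u *m dagger u))].
Proof.
move=> [fl ftp fcp] uu.
have [q [v [q0 q1 vv XE]]] := density_pure_decomposition (density_ptrace1 (density_pure uu)).
exists q, (fun j => v j *m dagger (v j)); split=> // [j|]; first exact: density_pure.
have [N [K fE]] := channel_kraus fl fcp.
rewrite (tens_map_id_kraus _ fl fE) entropy_gram_pure gram_tens XE gram_sum.
under eq_bigr => j _ do rewrite fE entropy_gram_pure.
by apply: entropy_concave => // j; exact: gram_pure_psd.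
Qed.

(** Mixed inputs reduce to pure ones: each pure component of [A] brings its own decomposition of its
    marginal, and the pair index multiplies the two families of weights. *)
Lemma entropy_tens_id (R : realType) d m n (f : 'M[R[i]]_m -> 'M[R[i]]_n)
    (A : 'M[R[i]]_(d * m)) :
  channel f -> density A ->
  exists (q : 'I_(d * m) * 'I_m -> R) (s : 'I_(d * m) * 'I_m -> 'M[R[i]]_m),
    [/\ forall j, 0 <= q j, \sum_j q j = 1, forall j, density (s j),
        ptrace1 A = \sum_j (q j)%:C%C *: s j
      & \sum_j q j * entropy (f (s j)) <= entropy (tens_map id f A)].
Proof.
move=> fch dA; have [l [u [l0 l1 uu AE]]] := density_pure_decomposition dA.
have /choice[q /choice[s qsP]] := fun j => entropy_tens_id_pure fch (uu j).
have q0 j : forall i, 0 <= q j i by case: (qsP j).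
have q1 j : \sum_i q j i = 1 by case: (qsP j).
exists (fun x => l x.1 * q x.1 x.2), (fun x => s x.1 x.2); split.
- by move=> x; rewrite mulr_ge0.
- rewrite -(pair_bigA _ (fun j i => l j * q j i))/= -l1.
  by apply: eq_bigr => j _; rewrite -mulr_sumr q1 mulr1.
- by move=> x; case: (qsP x.1).
- rewrite -(pair_bigA _ (fun j i => (l j * q j i)%:C%C *: s j i))/= {1}AE.
  rewrite ptrace1_sum.
  apply: eq_bigr => j _; have [_ _ _ -> _] := qsP j.
  by rewrite scaler_sumr; apply: eq_bigr => i _; rewrite scalerA -rmorphM.
rewrite -(pair_bigA _ (fun j i => l j * q j i * entropy (f (s j i))))/=.
have [fl _ fcp] := fch.
(* Linearity of [tens_map id f], read off its Kraus form. *)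
have -> : tens_map id f A = \sum_j (l j)%:C%C *: tens_map id f (u j *m dagger (u j)).
  have [N [K fE]] := channel_kraus fl fcp.
  rewrite (tens_map_id_kraus _ fl fE) AE.
  under eq_bigr => a _ do rewrite mulmx_sumr mulmx_suml.
  rewrite exchange_big/=; apply: eq_bigr => j _.
  rewrite (tens_map_id_kraus _ fl fE) scaler_sumr; apply: eq_bigr => a _.
  by rewrite -scalemxAr -scalemxAl.
apply: le_trans (entropy_concave l0 l1 _); last first.
  by move=> j; apply: fcp; exact: psd_mul_dagger.
apply: ler_sum => j _.
under eq_bigr do rewrite -mulrA.
by rewrite -mulr_sumr ler_wpM2l//; case: (qsP j).
Qed.

(** * The erasure channel *)

(** [W1] and [W2] side by side form an isometry, so the mixture has the entropy of a block diagonal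
    matrix. The two [xlnx] terms are the binary entropy. *)
Lemma entropy_orthogonal_mixture (R : realType) n a b (W1 : 'M[R[i]]_(n, a))
    (W2 : 'M[R[i]]_(n, b)) (A : 'M[R[i]]_a) (B : 'M[R[i]]_b) (eps : R) :
  dagger W1 *m W1 = 1%:M -> dagger W2 *m W2 = 1%:M -> dagger W2 *m W1 = 0 ->
  0 <= eps <= 1 -> density A -> density B ->
  entropy (eps%:C%C *: (W1 *m A *m dagger W1) + (1 - eps)%:C%C *: (W2 *m B *m dagger W2)) =
  eps * entropy A + (1 - eps) * entropy B - xlnx eps - xlnx (1 - eps).
Proof.
move=> W11 W22 W21 /andP[e0 e1] dA dB.
have W12 : dagger W1 *m W2 = 0.
  by rewrite -[LHS]daggerK daggerM daggerK W21; apply/matrixP => x y; rewrite !mxE conjC0.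
pose W := row_mx W1 W2.
pose D := block_mx (eps%:C%C *: A) 0 0 ((1 - eps)%:C%C *: B).
have -> : eps%:C%C *: (W1 *m A *m dagger W1) + (1 - eps)%:C%C *: (W2 *m B *m dagger W2) =
    W *m D *m dagger W.
  rewrite /W /D dagger_row_mx mul_row_block !mulmx0 addr0 add0r mul_row_col.
  by rewrite -!scalemxAr -!scalemxAl.
have WW : dagger W *m W = 1%:M.
  by rewrite /W dagger_row_mx mul_col_row W11 W12 W21 W22 -scalar_mx_block.
rewrite -mulmxA entropy_mulmxC -mulmxA WW mulmx1 entropy_block !entropyZ ?subr_ge0//.
ring.
Qed.

(** Nonnegative output entropies bound the set below, which makes [inf] a genuine lower bound. A
    general finite index type admits decompositions indexed by pairs; [enum_val] converts them to
    ordinals. *)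
Lemma Hmin_le (R : realType) (I : finType) m n (f : 'M[R[i]]_m -> 'M[R[i]]_n)
    (A : 'M[R[i]]_m) (p : I -> R) (s : I -> 'M[R[i]]_m) :
  (forall X, density X -> 0 <= entropy (f X)) ->
  (forall j, 0 <= p j) -> \sum_j p j = 1 -> (forall j, density (s j)) ->
  A = \sum_j (p j)%:C%C *: s j ->
  Hmin f A <= \sum_j p j * entropy (f (s j)).
Proof.
move=> f0 p0 p1 ds AE; apply: ge_inf.
  exists 0 => _ [N [q [r [q0 _ dr _ ->]]]].
  by apply: sumr_ge0 => j _; rewrite mulr_ge0// f0.
exists #|I|, (p \o enum_val), (s \o enum_val); split.
- by move=> j; exact: p0.
- by rewrite -p1 [RHS]big_enum_val.
- by move=> j; exact: ds.
- by rewrite AE [LHS]big_enum_val.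
- by rewrite [LHS]big_enum_val.
Qed.

Lemma le_Hmin (R : realType) m n (f : 'M[R[i]]_m -> 'M[R[i]]_n) (A : 'M[R[i]]_m) (x : R) :
  density A ->
  (forall (N : nat) (p : 'I_N -> R) (s : 'I_N -> 'M[R[i]]_m),
    (forall j, 0 <= p j) -> \sum_j p j = 1 -> (forall j, density (s j)) ->
    A = \sum_j (p j)%:C%C *: s j -> x <= \sum_j p j * entropy (f (s j))) ->
  x <= Hmin f A.
Proof.
move=> dA lex; apply: lb_le_inf => [|_ [N [p [s [p0 p1 ds AE ->]]]]]; last exact: lex.
(* The one-term decomposition of [A] shows that the set is nonempty, so that [inf] is not a default
   value. *)
exists (entropy (f A)), 1%N, (fun=> 1), (fun=> A).
by split=> //; rewrite big_ord1 ?scale1r ?mul1r.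
Qed.

Lemma entropy_pure (R : realType) n (u : 'cV[R[i]]_n) :
  dagger u *m u = 1%:M -> entropy (u *m dagger u) = 0.
Proof.
move=> uu; rewrite entropy_mulmxC uu.
have -> : 1%:M = diag_mx (\row_j (1 : R)%:C%C) :> 'M[R[i]]_1.
  by apply/matrixP => a b; rewrite !ord1 !mxE.
by rewrite entropy_diag big_ord1 xlnx1 oppr0.
Qed.

Lemma mul_tensmx1E (R : realType) k m n p (A : 'M[R[i]]_(n, m)) (Y : 'M[R[i]]_(m * k, p)) a c y :
  ((A *t 1%:M) *m Y) (mxtens_index (a, c)) y = \sum_a' A a a' * Y (mxtens_index (a', c)) y.
Proof.
rewrite mxE big_mxtens; apply: eq_bigr => a' _.
rewrite (bigD1 c)//= big1 => [|c' /negPf nc]; rewrite tensmxE mxE.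
  by rewrite eqxx mulr1 addr0.
by rewrite eq_sym nc mulr0 mul0r.
Qed.

Lemma mul_mxtensmx1E (R : realType) k m n p (A : 'M[R[i]]_(m, n)) (Y : 'M[R[i]]_(p, m * k)) b e y :
  (Y *m (A *t 1%:M)) y (mxtens_index (b, e)) = \sum_b' Y y (mxtens_index (b', e)) * A b' b.
Proof.
rewrite mxE big_mxtens; apply: eq_bigr => b' _.
rewrite (bigD1 e)//= big1 => [|e' /negPf ne]; rewrite tensmxE mxE.
  by rewrite eqxx mulr1 addr0.
by rewrite ne mulr0 mulr0.
Qed.

Lemma trace_delta_mx (R : nzRingType) n (a b : 'I_n) :
  \tr (delta_mx a b : 'M[R]_n) = (a == b)%:R.
Proof.
rewrite /mxtrace (bigD1 a)//= big1 => [|x /negPf xa]; rewrite mxE ?eqxx ?addr0//.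
by rewrite xa.
Qed.

Section Erasure.

Variables (R : realType) (d : nat) (V : 'M[R[i]]_(d.+1, d)) (w : 'cV[R[i]]_d.+1) (eps : R).
Hypotheses (VV : dagger V *m V = 1%:M) (ww : dagger w *m w = 1%:M) (Vw : dagger V *m w = 0).
Hypothesis eps01 : 0 <= eps <= 1.

Lemma entropy_erasure (A : 'M[R[i]]_d) : density A ->
  entropy (erasure V w eps A) = (1 - eps) * entropy A - xlnx eps - xlnx (1 - eps).
Proof.
move=> dA; have d1 : density (1%:M : 'M[R[i]]_1).
  by have := @density_pure R 1 1%:M; rewrite dagger1 mulmx1; apply.
have S1 : entropy (1%:M : 'M[R[i]]_1) = 0.
  by have := @entropy_pure R 1 1%:M; rewrite dagger1 mulmx1; apply.
(* Inserting [1%:M] presents the flag as the one-dimensional state carried by the isometry [w]. *)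
rewrite /erasure dA.2 mulr1 -{1}[w]mulmx1 entropy_orthogonal_mixture//.
by rewrite S1 mulr0 add0r.
Qed.

Lemma Hmin_erasure_le (A : 'M[R[i]]_d) : density A ->
  Hmin (erasure V w eps) A <= - xlnx eps - xlnx (1 - eps).
Proof.
move=> dA; have [l [u [l0 l1 uu AE]]] := density_pure_decomposition dA.
have du j : density (u j *m dagger (u j)) by exact: density_pure.
have Su j : entropy (u j *m dagger (u j)) = 0 by exact: entropy_pure.
apply: le_trans (Hmin_le _ l0 l1 du AE) _.
  move=> X dX; rewrite entropy_erasure//; case/andP: eps01 => e0 e1.
  have := entropy_ge0 dX; have := @xlnx_le0 R eps; have := @xlnx_le0 R (1 - eps).
  by nra.
under eq_bigr do rewrite entropy_erasure// Su mulr0 add0r.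
by rewrite -mulr_suml l1 mul1r.
Qed.

(** The isometry sending a vector [x] to [w] tensor [x]; [colsub] identifies the column index
    [1 * k] with [k]. *)
Let W1 k : 'M[R[i]]_(d.+1 * k, k) :=
  colsub (fun c => mxtens_index (ord0, c)) (w *t (1%:M : 'M[R[i]]_k)).
Let W2 k : 'M[R[i]]_(d.+1 * k, d * k) := V *t (1%:M : 'M[R[i]]_k).

Let dagger_W1 k : dagger (W1 k) =
  rowsub (fun c => mxtens_index (ord0, c)) (dagger w *t (1%:M : 'M[R[i]]_k)).
Proof.
by rewrite -[X in _ *t X]dagger1 -dagger_tens; apply/matrixP => x y; rewrite !mxE.
Qed.

Let tens11 a b : (1%:M : 'M[R[i]]_a) *t (1%:M : 'M[R[i]]_b) = 1%:M.
Proof.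
apply/matrixP => x y; case: (mxtens_indexP x) => ? ?; case: (mxtens_indexP y) => ? ?.
by rewrite tensmxE !mxE -natrM mulnb (can_eq (@mxtens_indexK _ _)).
Qed.

(** On matrix units the flag term carries the trace, so it collects only diagonal blocks, which add
    up to [ptrace1 A]; the other term conjugates by [V] on the first factor. *)
Lemma tens_map_erasure k (f : 'M[R[i]]_k -> 'M[R[i]]_k) (A : 'M[R[i]]_(d * k)) :
  linear_map f ->
  tens_map (erasure V w eps) f A =
  eps%:C%C *: (W1 k *m f (ptrace1 A) *m dagger (W1 k)) +
  (1 - eps)%:C%C *: (W2 k *m tens_map id f A *m dagger (W2 k)).
Proof.
move=> fl; apply/matrixP => x y.
case: (mxtens_indexP x) => a c; case: (mxtens_indexP y) => b e.
have W1E : (W1 k *m f (ptrace1 A) *m dagger (W1 k)) (mxtens_index (a, c)) (mxtens_index (b, e)) =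
    (w *m dagger w) a b * f (ptrace1 A) c e.
  rewrite mxE (bigD1 e)//= [X in _ + X]big1 => [|e' /negPf ne]; last first.
    by rewrite dagger_W1 [X in _ * X]mxE tensmxE [X in _ * (_ * X)]mxE ne !mulr0.
  rewrite addr0 mxE (bigD1 c)//= [X in _ + X]big1 => [|c' /negPf nc]; last first.
    by rewrite [X in X * _]mxE tensmxE [X in _ * X * _]mxE eq_sym nc mulr0 mul0r.
  rewrite addr0 dagger_W1 [W1 k _ _]mxE tensmxE [X in _ * X * _ * _]mxE eqxx mulr1.
  rewrite [X in _ * X]mxE tensmxE [X in _ * (_ * X)]mxE eqxx mulr1 [RHS]mulrC [in RHS]mxE big_ord1.
  by rewrite mulrAC mulrC.
rewrite tens_mapE// [RHS]mxE [X in X + _]mxE [X in _ + X]mxE W1E.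
rewrite /W2 dagger_tens dagger1 mul_mxtensmx1E.
have -> : \sum_b' (V *t 1%:M *m tens_map id f A) (mxtens_index (a, c)) (mxtens_index (b', e)) *
    dagger V b' b =
    \sum_a' \sum_b' (V *m delta_mx a' b' *m dagger V) a b * f (tens_block A a' b') c e.
  rewrite exchange_big; apply: eq_bigr => b' _; rewrite mul_tensmx1E mulr_suml.
  apply: eq_bigr => a' _; rewrite (tens_map_idE _ _ _ _ _ fl).
  have -> : (V *m delta_mx a' b' *m dagger V) a b = V a a' * dagger V b' b.
    rewrite -(mul_delta_mx (ord0 : 'I_1)) mulmxA -colE -mulmxA -rowE mxE big_ord1.
    by rewrite [col _ _ _ _]mxE [row _ _ _ _]mxE.
  by rewrite mulrAC.
rewrite ptrace1_block (linear_map_sum _ fl) summxE !mulr_sumr -big_split/=.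
apply: eq_bigr => a' _; rewrite mulr_sumr.
(* The unit with [b' = a'] has trace one and supplies the flag term; all others have trace zero. *)
rewrite (bigD1 a')//= [in RHS](bigD1 a')//= addrA; congr (_ + _).
  rewrite /erasure mxE [X in X + _]mxE [X in _ + X]mxE trace_delta_mx eqxx.
  by rewrite mulr1; ring.
apply: eq_bigr => b' /negPf nb.
rewrite /erasure mxE [X in X + _]mxE [X in _ + X]mxE.
by rewrite trace_delta_mx eq_sym nb mulr0 mul0r add0r mulrA.
Qed.

Lemma entropy_tens_map_erasure k (f : 'M[R[i]]_k -> 'M[R[i]]_k) (A : 'M[R[i]]_(d * k)) :
  channel f -> density A ->
  entropy (tens_map (erasure V w eps) f A) =
  eps * entropy (f (ptrace1 A)) + (1 - eps) * entropy (tens_map id f A)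
    - xlnx eps - xlnx (1 - eps).
Proof.
move=> fch dA; have [fl _ _] := fch.
rewrite tens_map_erasure// entropy_orthogonal_mixture//.
(* The conditions on [W1 k] and [W2 k] come from those on [w] and [V]; orthogonality of their ranges
   is [Vw]. *)
- rewrite dagger_W1 mul_rowsub_mx mulmx_colsub tensmx_mul ww mulmx1 tens11.
  apply/matrixP => x y; rewrite !mxE (can_eq (@mxtens_indexK _ _)).
  by rewrite xpair_eqE eqxx.
- by rewrite dagger_tens dagger1 tensmx_mul VV mulmx1 tens11.
- rewrite dagger_tens dagger1 mulmx_colsub tensmx_mul Vw tens0mx.
  by apply/matrixP => x y; rewrite !mxE.
- exact/channel_density/density_ptrace1.
- exact: tens_map_id_density.
Qed.

End Erasure.

(** * Combination of the erased and transmitted branches *)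

Theorem theorem6 (R : realType) (d k : nat)
  (V : 'M[R[i]]_(d.+1, d)) (w : 'cV[R[i]]_d.+1) (eps : R) :
  dagger V *m V = 1%:M ->
  dagger w *m w = 1%:M ->
  dagger V *m w = 0 ->
  0 <= eps <= 1 ->
  forall (Omega : 'M[R[i]]_k -> 'M[R[i]]_k), channel Omega ->
  forall rho : 'M[R[i]]_(d * k), density rho ->
  Hmin (erasure V w eps) (ptrace2 rho) + Hmin Omega (ptrace1 rho)
    <= Hmin (tens_map (erasure V w eps) Omega) rho.
Proof.
move=> VV ww Vw eps01 Omega Och rho drho.
have O0 X : density X -> 0 <= entropy (Omega X).
  by move=> dX; exact/entropy_ge0/channel_density.
(* The first summand is replaced by the binary entropy, which appears in every output entropy on the
   right. *)
apply: le_trans (lerD (Hmin_erasure_le VV ww Vw eps01 (density_ptrace2 drho)) (lexx _)) _.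
apply: le_Hmin => // N p s p0 p1 ds rhoE.
under eq_bigr do rewrite entropy_tens_map_erasure//.
have rhoKE : ptrace1 rho = \sum_j (p j)%:C%C *: ptrace1 (s j) by rewrite rhoE ptrace1_sum.
(* Erased branch: the marginals of the [s j] already decompose that of [rho]. *)
have le1 : Hmin Omega (ptrace1 rho) <= \sum_j p j * entropy (Omega (ptrace1 (s j))).
  by apply: Hmin_le => // j; exact: density_ptrace1.
(* Transmitted branch: each marginal is decomposed further by [entropy_tens_id], and the pieces over
   all [j] together decompose the marginal of [rho]. *)
have le2 : Hmin Omega (ptrace1 rho) <= \sum_j p j * entropy (tens_map id Omega (s j)).
  have /choice[q /choice[t qtP]] := fun j => entropy_tens_id Och (ds j).
  have q0 j : forall i, 0 <= q j i by case: (qtP j).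
  have q1 j : \sum_i q j i = 1 by case: (qtP j).
  have := @Hmin_le R ('I_N * ('I_(d * k) * 'I_k))%type k k Omega (ptrace1 rho)
    (fun x => p x.1 * q x.1 x.2) (fun x => t x.1 x.2) O0.
  rewrite -(pair_bigA _ (fun j i => p j * q j i))/=.
  rewrite -(pair_bigA _ (fun j i => (p j * q j i)%:C%C *: t j i))/=.
  rewrite -(pair_bigA _ (fun j i => p j * q j i * entropy (Omega (t j i))))/=.
  move=> le_H; apply: (le_trans (le_H _ _ _ _)).
  - by move=> x; rewrite mulr_ge0.
  - by rewrite -p1; apply: eq_bigr => j _; rewrite -mulr_sumr q1 mulr1.
  - by move=> x; case: (qtP x.1).
  - rewrite rhoKE; apply: eq_bigr => j _; have [_ _ _ -> _] := qtP j.
    by rewrite scaler_sumr; apply: eq_bigr => i _; rewrite scalerA -rmorphM.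
  - apply: ler_sum => j _; under eq_bigr do rewrite -mulrA.
    by rewrite -mulr_sumr ler_wpM2l//; case: (qtP j).
rewrite (eq_bigr (fun j => eps * (p j * entropy (Omega (ptrace1 (s j)))) +
  (1 - eps) * (p j * entropy (tens_map id Omega (s j))) +
  p j * (- xlnx eps - xlnx (1 - eps)))) => [|j _]; last ring.
rewrite !big_split -!mulr_sumr -mulr_suml p1 mul1r/=.
(* This is [eps] times [le1] plus [1 - eps] times [le2]; the binary entropies cancel. *)
by case/andP: eps01 => e0 e1; nra.
Qed.
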